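(* The residuated basic logic $\mathsf{RBL}$ is a conservative extension of $\mathsf{BPL}$: for every $\mathcal{L}_{\mathrm{BPL}}$-formula $A$, $A$ is provable in $\mathsf{BPL}$ if and only if $A\in\mathsf{RBL}$.
   Context: $\mathcal{L}_{\mathrm{BPL}}$-formulas are built from propositional letters and $\bot,\top$ by $\wedge,\vee,\rightarrow$; $\mathcal{L}_{\mathrm{RBL}}$-formulas additionally use binary connectives $\cdot$ and $\leftarrow$. $\mathsf{BPL}$ is the Hilbert system with axioms (for all formulas $A,B,C$): $A\rightarrow A$; $A\rightarrow(B\rightarrow A)$; $(A\rightarrow B)\wedge(B\rightarrow C)\rightarrow(A\rightarrow C)$; $(A\rightarrow C)\wedge(B\rightarrow C)\rightarrow(A\vee B\rightarrow C)$; $A\wedge B\rightarrow A$; $A\wedge B\rightarrow B$; $A\rightarrow A\vee B$; $B\rightarrow A\vee B$; $A\rightarrow(B\rightarrow A\wedge B)$; $(A\rightarrow B)\wedge(A\rightarrow C)\rightarrow(A\rightarrow B\wedge C)$; $A\wedge(B\vee C)\rightarrow(A\wedge B)\vee(A\wedge C)$; $\bot\rightarrow A$; and modus ponens. A residuated basic algebra is $(\mathsf{A},\wedge,\vee,\top,\bot,\rightarrow,\leftarrow,\cdot)$ where $(\mathsf{A},\wedge,\vee,\top,\bot)$ is a bounded distributive lattice with order $\leq$ and $\cdot,\rightarrow,\leftarrow$ are binary operations with $a\cdot b\leq c$ iff $b\leq a\rightarrow c$ iff $a\leq c\leftarrow b$ ($\cdot$ not assumed associative), and $a\cdot\top\leq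 a$, $\top\cdot a\leq a$, $a\cdot b\leq(a\cdot b)\cdot b$ for all $a,b$. $\mathsf{RBL}$ is the set of $\mathcal{L}_{\mathrm{RBL}}$-formulas $A$ such that $\sigma(A)=\top$ for every residuated basic algebra and every assignment $\sigma$ (homomorphism from the formula algebra) into it.
   Formalization: The axiom A→⊤ is added to the listed axioms of BPL: ⊤ is a primitive constant that no listed axiom governs, so ⊤ would be unprovable although it lies in RBL; provability of ⊤-free formulas is unchanged. *)

(* Defs.v *)
From HB Require Import structures.
From mathcomp Require Import all_boot all_order.

Set Implicit Arguments.
Unset Strict Implicit.
Unset Printing Implicit Defensive.

Declare Scope bpl_scope.
Delimit Scope bpl_scope with bpl.
Declare Scope rbl_scope.
Delimit Scope rbl_scope with rbl.

Inductive bpl_formula : Type :=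
| BVar of nat
| BBot
| BTop
| BAnd of bpl_formula & bpl_formula
| BOr of bpl_formula & bpl_formula
| BImp of bpl_formula & bpl_formula.

Bind Scope bpl_scope with bpl_formula.
Notation "⊥" := BBot : bpl_scope.
Notation "⊤" := BTop : bpl_scope.
Notation "A ∧ B" := (BAnd A B) (at level 40, left associativity) : bpl_scope.
Notation "A ∨ B" := (BOr A B) (at level 50, left associativity) : bpl_scope.
Notation "A ⟶ B" := (BImp A B) (at level 55, right associativity) : bpl_scope.

Inductive rbl_formula : Type :=
| RVar of nat
| RBot
| RTop
| RAnd of rbl_formula & rbl_formula
| ROr of rbl_formula & rbl_formula
| RImp of rbl_formula & rbl_formula
| RDot of rbl_formula & rbl_formula
| RLimp of rbl_formula & rbl_formula.

Bind Scope rbl_scope with rbl_formula.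
Notation "⊥" := RBot : rbl_scope.
Notation "⊤" := RTop : rbl_scope.
Notation "A ∧ B" := (RAnd A B) (at level 40, left associativity) : rbl_scope.
Notation "A ∨ B" := (ROr A B) (at level 50, left associativity) : rbl_scope.
Notation "A ⟶ B" := (RImp A B) (at level 55, right associativity) : rbl_scope.
Notation "A ⋅ B" := (RDot A B) (at level 38, left associativity) : rbl_scope.
Notation "A ⟵ B" := (RLimp A B) (at level 54, left associativity) : rbl_scope.

Fixpoint rbl_of_bpl (A : bpl_formula) : rbl_formula :=
  match A with
  | BVar p => RVar p
  | BBot => RBot
  | BTop => RTop
  | BAnd B C => RAnd (rbl_of_bpl B) (rbl_of_bpl C)
  | BOr B C => ROr (rbl_of_bpl B) (rbl_of_bpl C)
  | BImp B C => RImp (rbl_of_bpl B) (rbl_of_bpl C)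
  end.

(* [ax_top] is needed because ⊤ is a primitive constant: none of the other
   axioms mentions it, so without [ax_top] it would behave as a propositional
   letter and ⊤ itself would not be derivable.  On ⊤-free formulas [ax_top] is
   conservative: replacing ⊤ by ⊥ ⟶ ⊥ in a derivation turns the instances of
   [ax_top] into formulas derivable from the other axioms. *)
Inductive BPL_axiom : bpl_formula -> Prop :=
| ax_id A : BPL_axiom (A ⟶ A)
| ax_weak A B : BPL_axiom (A ⟶ (B ⟶ A))
| ax_trans A B C : BPL_axiom ((A ⟶ B) ∧ (B ⟶ C) ⟶ (A ⟶ C))
| ax_or_elim A B C : BPL_axiom ((A ⟶ C) ∧ (B ⟶ C) ⟶ (A ∨ B ⟶ C))
| ax_and_l A B : BPL_axiom (A ∧ B ⟶ A)
| ax_and_r A B : BPL_axiom (A ∧ B ⟶ B)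
| ax_or_l A B : BPL_axiom (A ⟶ A ∨ B)
| ax_or_r A B : BPL_axiom (B ⟶ A ∨ B)
| ax_pair A B : BPL_axiom (A ⟶ (B ⟶ A ∧ B))
| ax_and_intro A B C : BPL_axiom ((A ⟶ B) ∧ (A ⟶ C) ⟶ (A ⟶ B ∧ C))
| ax_distr A B C : BPL_axiom (A ∧ (B ∨ C) ⟶ (A ∧ B) ∨ (A ∧ C))
| ax_bot A : BPL_axiom (⊥ ⟶ A)
| ax_top A : BPL_axiom (A ⟶ ⊤).

Inductive BPL_provable : bpl_formula -> Prop :=
| BPL_ax A : BPL_axiom A -> BPL_provable A
| BPL_mp A B : BPL_provable (A ⟶ B) -> BPL_provable A -> BPL_provable B.

HB.mixin Record TBDistrLattice_isResiduatedBasic (d : Order.disp_t) (T : Type)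
    of Order.TBDistrLattice d T := {
  rba_dot : T -> T -> T;
  rba_imp : T -> T -> T;
  (* [rba_limp c b] is c ← b *)
  rba_limp : T -> T -> T;
  rba_dot_imp : forall a b c : T,
    (rba_dot a b <= c)%O <-> (b <= rba_imp a c)%O;
  rba_dot_limp : forall a b c : T,
    (rba_dot a b <= c)%O <-> (a <= rba_limp c b)%O;
  rba_dotx1 : forall a : T, (rba_dot a \top <= a)%O;
  rba_dot1x : forall a : T, (rba_dot \top a <= a)%O;
  rba_dot_contr : forall a b : T,
    (rba_dot a b <= rba_dot (rba_dot a b) b)%O
}.

#[short(type="residuatedBasicAlgebra")]
HB.structure Definition ResiduatedBasicAlgebra (d : Order.disp_t) :=
  { T of Order.TBDistrLattice d T & TBDistrLattice_isResiduatedBasic d T }.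

Record is_assignment (d : Order.disp_t) (M : residuatedBasicAlgebra d)
    (s : rbl_formula -> M) : Prop := {
  assign_bot : s ⊥%rbl = \bot%O;
  assign_top : s ⊤%rbl = \top%O;
  assign_and : forall A B, s (A ∧ B)%rbl = (s A `&` s B)%O;
  assign_or : forall A B, s (A ∨ B)%rbl = (s A `|` s B)%O;
  assign_imp : forall A B, s (A ⟶ B)%rbl = rba_imp (s A) (s B);
  assign_dot : forall A B, s (A ⋅ B)%rbl = rba_dot (s A) (s B);
  assign_limp : forall A B, s (A ⟵ B)%rbl = rba_limp (s A) (s B)
}.

Definition RBL (A : rbl_formula) : Prop :=
  forall (d : Order.disp_t) (M : residuatedBasicAlgebra d)
         (s : rbl_formula -> M),
    is_assignment s -> s A = \top%O.

(* Main.v *)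
(** Every BPL axiom is an implication whose premise lies below its conclusion
    in each residuated basic algebra.  Modus ponens is not sound in a single
    algebra, since [a → b = ⊤] does not imply [a ≤ b]; but adding a new top
    above the old one (dually, a new root seeing a whole Kripke frame) yields a
    residuated basic algebra in which [a → b] is the new top only if [a ≤ b]
    held in the old algebra, so validity in all algebras is closed under modus
    ponens.  Conversely, the upsets of a transitive, not necessarily reflexive,
    Kripke frame form a residuated basic algebra; over the canonical frame of
    prime theories this algebra refutes every unprovable formula. *)
From HB Require Import structures.
From mathcomp Require Import all_boot all_order.
From mathcomp Require Import boolp classical_sets.
Require Import Defs.

Set Implicit Arguments.
Unset Strict Implicit.
Unset Printing Implicit Defensive.

Import Order.TTheory.

(** * Order laws in residuated basic algebras *)

Section RBATheory.
Context {d : Order.disp_t} {M : residuatedBasicAlgebra d}.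
Implicit Types a b c x y z : M.
Local Open Scope order_scope.

Lemma rba_dot_monor x y z : y <= z -> rba_dot x y <= rba_dot x z.
Proof. by move=> le_yz; apply/rba_dot_imp/(le_trans le_yz)/rba_dot_imp. Qed.

Lemma rba_dot_monol x y z : y <= z -> rba_dot y x <= rba_dot z x.
Proof. by move=> le_yz; apply/rba_dot_limp/(le_trans le_yz)/rba_dot_limp. Qed.

Lemma rba_dot_lel x y : rba_dot x y <= x.
Proof. exact: le_trans (rba_dot_monor x (lex1 y)) (rba_dotx1 x). Qed.

Lemma rba_dot_ler x y : rba_dot x y <= y.
Proof. exact: le_trans (rba_dot_monol y (lex1 x)) (rba_dot1x y). Qed.

Lemma rba_imp_eq1 x y : x <= y -> rba_imp x y = \top.
Proof.
by move=> le_xy; apply/eqP; rewrite -le1x; apply/rba_dot_imp/(le_trans (rba_dotx1 x)).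
Qed.

(** The contraction law lets [y] be used twice: first to pass from [a] to [b], then from [b] to
    [c]. *)
Lemma rba_imp_trans a b c : rba_imp a b `&` rba_imp b c <= rba_imp a c.
Proof.
set y := _ `&` _; apply/rba_dot_imp/(le_trans (rba_dot_contr a y)).
have le_ab : rba_dot a y <= b by apply/rba_dot_imp/leIl.
by apply: le_trans (rba_dot_monol y le_ab) _; apply/rba_dot_imp/leIr.
Qed.

Lemma rba_imp_join a b c : rba_imp a c `&` rba_imp b c <= rba_imp (a `|` b) c.
Proof.
(* The right residual is traded for the left one, which leaves the join alone on the left of the
   inequality. *)
apply/rba_dot_imp/rba_dot_limp; rewrite leUx; apply/andP; split.
  by apply/rba_dot_limp/rba_dot_imp/leIl.
by apply/rba_dot_limp/rba_dot_imp/leIr.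
Qed.

Lemma rba_imp_meet a b c : rba_imp a b `&` rba_imp a c <= rba_imp a (b `&` c).
Proof.
apply/rba_dot_imp; rewrite lexI; apply/andP; split.
  by apply/rba_dot_imp/leIl.
by apply/rba_dot_imp/leIr.
Qed.

Fixpoint rba_eval (v : nat -> M) (A : rbl_formula) : M :=
  match A with
  | RVar p => v p
  | RBot => \bot
  | RTop => \top
  | RAnd B C => rba_eval v B `&` rba_eval v C
  | ROr B C => rba_eval v B `|` rba_eval v C
  | RImp B C => rba_imp (rba_eval v B) (rba_eval v C)
  | RDot B C => rba_dot (rba_eval v B) (rba_eval v C)
  | RLimp B C => rba_limp (rba_eval v B) (rba_eval v C)
  end.

Lemma rba_eval_assignment (v : nat -> M) : is_assignment (rba_eval v).
Proof. by []. Qed.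

End RBATheory.

Lemma BPL_axiom_sound (A : bpl_formula) : BPL_axiom A -> RBL (rbl_of_bpl A).
Proof.
move=> axA d M s [sbot stop sand sor simp _ _].
by case: axA => * /=; rewrite simp rba_imp_eq1 // ?(sbot, stop, sand, sor, simp)
  ?(le0x, lex1, leIl, leIr, leUl, leUr, rba_imp_trans, rba_imp_join, rba_imp_meet, meetUr) //;
  (* What remains is weakening and pairing; residuation reduces them to a product lying below its
     factors. *)
  apply/rba_dot_imp; rewrite ?lexI ?(rba_dot_ler, rba_dot_lel).
Qed.

(** * Adjoining a new top to an algebra *)

Section AddTop.
Context {d : Order.disp_t} (M : residuatedBasicAlgebra d).
Local Open Scope order_scope.

(* [None] is the new top, [Some \top] the old one. *)
Definition add_top : Type := option M.

HB.instance Definition _ := Choice.copy add_top (option M).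

Implicit Types x y z : add_top.

(** Restriction of an upset to the old frame: both tops become the old one. *)
Definition cut_top x : M := odflt \top x.

Definition at_le x y : bool :=
  match x, y with
  | _, None => true
  | None, Some _ => false
  | Some a, Some b => a <= b
  end.

Definition at_meet x y : add_top :=
  match x, y with
  | None, _ => y
  | _, None => x
  | Some a, Some b => Some (a `&` b)
  end.

Definition at_join x y : add_top :=
  match x, y with
  | None, _ | _, None => None
  | Some a, Some b => Some (a `|` b)
  end.

Fact at_le_refl : reflexive at_le.
Proof. by case=> /=. Qed.

Fact at_le_anti : antisymmetric at_le.
Proof. by move=> [a|] [b|] //= /le_anti ->. Qed.

Fact at_le_trans : transitive at_le.
Proof. by move=> [a|] [b|] [c|] //=; apply: le_trans. Qed.

HB.instance Definition _ :=
  Order.Le_isPOrder.Build d add_top at_le_refl at_le_anti at_le_trans.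

Fact at_meetP x y z : (x <= at_meet y z) = (x <= y) && (x <= z).
Proof. by case: x y z => [a|] [b|] [c|]; rewrite /Order.le //= ?lexI ?andbT. Qed.

Fact at_joinP x y z : (at_join x y <= z) = (x <= z) && (y <= z).
Proof. by case: x y z => [a|] [b|] [c|]; rewrite /Order.le //= ?leUx ?andbF. Qed.

HB.instance Definition _ :=
  Order.POrder_MeetJoin_isLattice.Build d add_top at_meetP at_joinP.

Fact at_meetUl : left_distributive at_meet at_join.
Proof.
move=> [a|] [b|] [c|] //=; congr Some; rewrite ?meetUl ?joinxx //.
  by rewrite meetUK.
by rewrite meetKUC.
Qed.

HB.instance Definition _ :=
  Order.Lattice_Meet_isDistrLattice.Build d add_top at_meetUl.

Fact at_le0x x : (Some \bot : add_top) <= x.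
Proof. by case: x => [a|]; rewrite /Order.le //= le0x. Qed.

HB.instance Definition _ := Order.hasBottom.Build d add_top at_le0x.

Fact at_lex1 x : x <= (None : add_top).
Proof. by case: x. Qed.

HB.instance Definition _ := Order.hasTop.Build d add_top at_lex1.

(* The operations of the upset algebra of a frame extended with a root that
   sees every other world; [None] is the only upset containing the root. *)
Definition at_dot x y : add_top :=
  Some (if y is Some b then rba_dot (cut_top x) b else cut_top x).

Definition at_imp x z : add_top :=
  if cut_top x <= cut_top z then None else Some (rba_imp (cut_top x) (cut_top z)).

Definition at_limp z y : add_top :=
  let c := if y is Some b then rba_limp (cut_top z) b else cut_top z in
  if c == \top then None else Some c.

(** Products are never [None], so this carries each law on [at_dot] back to [M]. *)
Lemma at_le_Some (a : M) x : ((Some a : add_top) <= x) = (a <= cut_top x).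
Proof. by case: x => [b|] //; apply/esym/lex1. Qed.

Fact at_dot_imp x y z : (at_dot x y <= z) <-> (y <= at_imp x z).
Proof.
rewrite /at_dot /at_imp at_le_Some; case: y => [b|]; last by case: ifP.
case: ifP => [le_xz|_]; last exact: rba_dot_imp.
(* The residual is the new top here, so the left side must hold outright: a product lies below its
   left factor. *)
by split=> // _; apply: le_trans (rba_dot_lel _ _) le_xz.
Qed.

Fact at_dot_limp x y z : (at_dot x y <= z) <-> (x <= at_limp z y).
Proof.
rewrite /at_dot /at_limp at_le_Some /=.
set c := if y is Some b then _ else cut_top z.
have -> : (if y is Some b then rba_dot (cut_top x) b else cut_top x) <= cut_top z
    <-> cut_top x <= c.
  by rewrite /c; case: y {c} => [b|] //; apply: rba_dot_limp.
(* At [x = None] the value [cut_top x] is the old top, so [cut_top x <= c] holds only for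
   [c = \top]; this is why [at_limp] then has to be the new top. *)
case: eqP => [->|/eqP c_neq1]; first by rewrite lex1; split=> // _; apply: lex1.
by case: x => [a|] //=; rewrite le1x (negPf c_neq1).
Qed.

Fact at_dotx1 x : at_dot x \top <= x.
Proof. by rewrite at_le_Some. Qed.

Fact at_dot1x x : at_dot \top x <= x.
Proof. by rewrite at_le_Some; case: x => [a|] //=; apply: rba_dot1x. Qed.

Fact at_dot_contr x y : at_dot x y <= at_dot (at_dot x y) y.
Proof. by rewrite at_le_Some; case: y => [b|] //=; apply: rba_dot_contr. Qed.

HB.instance Definition _ :=
  TBDistrLattice_isResiduatedBasic.Build d add_top
    at_dot_imp at_dot_limp at_dotx1 at_dot1x at_dot_contr.

Lemma cut_top_imp x y : cut_top (rba_imp x y) = rba_imp (cut_top x) (cut_top y).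
Proof.
change (cut_top (at_imp x y) = rba_imp (cut_top x) (cut_top y)).
by rewrite /at_imp; case: ifP => // le_xy; rewrite rba_imp_eq1.
Qed.

(** [at_imp] is the new top only in its first branch. This converse of [rba_imp_eq1], up to
    [cut_top], can fail in [M] itself. *)
Lemma add_top_imp_eq1 x y : rba_imp x y = \top -> cut_top x <= cut_top y.
Proof.
change (at_imp x y = None -> cut_top x <= cut_top y).
by rewrite /at_imp; case: ifP.
Qed.

(* [cut_top] commutes with the BPL operations, but not with [rba_dot]. *)
Lemma cut_top_eval (s : rbl_formula -> M) (A : bpl_formula) :
  is_assignment s ->
  cut_top (rba_eval (fun p => Some (s (RVar p)) : add_top) (rbl_of_bpl A))
    = s (rbl_of_bpl A).
Proof.
move=> [sbot stop sand sor simp _ _].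
elim: A => [p|||A IHA B IHB|A IHA B IHB|A IHA B IHB] //=.
- by rewrite sand -IHA -IHB; move: (rba_eval _ _) (rba_eval _ _)
    => [a|] [b|] //=; rewrite ?meetx1 ?meet1x.
- by rewrite sor -IHA -IHB; move: (rba_eval _ _) (rba_eval _ _)
    => [a|] [b|] //=; rewrite ?joinx1 ?join1x.
- by rewrite simp -IHA -IHB cut_top_imp.
Qed.

End AddTop.

(** * Soundness *)

(** Validity of the implication is used in [add_top M], under the valuation that copies [s]; the
    inequality found there is cut back to [M]. *)
Lemma RBL_imp_le (A B : bpl_formula) (d : Order.disp_t)
    (M : residuatedBasicAlgebra d) (s : rbl_formula -> M) :
  RBL (rbl_of_bpl (A ⟶ B)) -> is_assignment s ->
  (s (rbl_of_bpl A) <= s (rbl_of_bpl B))%O.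
Proof.
move=> AB_valid s_assign; rewrite -!(cut_top_eval _ s_assign).
exact/add_top_imp_eq1/(AB_valid _ _ _ (rba_eval_assignment _)).
Qed.

Lemma BPL_sound (A : bpl_formula) : BPL_provable A -> RBL (rbl_of_bpl A).
Proof.
elim=> {A} [A /BPL_axiom_sound//|A B _ AB_valid _ A_valid d M s s_assign].
apply/eqP; rewrite -le1x -(A_valid _ _ _ s_assign).
exact: RBL_imp_le.
Qed.

(** * Upset algebras of transitive frames *)

Record transitive_frame := TransitiveFrame {
  world :> Type;
  acc : world -> world -> Prop;
  acc_trans : forall u v w, acc u v -> acc v w -> acc u w
}.

Section UpsetAlgebra.
Variable K : transitive_frame.

Record upset := Upset {
  upset_pred :> K -> Prop;
  upsetP : forall w v, acc w v -> upset_pred w -> upset_pred v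
}.

HB.instance Definition _ := gen_eqMixin upset.
HB.instance Definition _ := gen_choiceMixin upset.

Implicit Types X Y Z : upset.

Lemma upset_ext X Y : (forall w, X w <-> Y w) -> X = Y.
Proof.
case: X Y => [X upX] [Y upY] /= eqXY.
have {}eqXY : X = Y by apply/funext => w; apply/propext.
by subst Y; congr Upset; apply: Prop_irrelevance.
Qed.

Definition up_le X Y := `[< forall w, X w -> Y w >].

Fact up_le_refl : reflexive up_le.
Proof. by move=> X; apply/asboolP. Qed.

Fact up_le_anti : antisymmetric up_le.
Proof.
move=> X Y /andP[/asboolP leXY /asboolP leYX].
by apply: upset_ext => w; split=> [/leXY|/leYX].
Qed.

Fact up_le_trans : transitive up_le.
Proof.
by move=> Y X Z /asboolP leXY /asboolP leYZ; apply/asboolP => w /leXY/leYZ.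
Qed.

Fact up_display : Order.disp_t. Proof. exact. Qed.

HB.instance Definition _ :=
  Order.Le_isPOrder.Build up_display upset up_le_refl up_le_anti up_le_trans.

Lemma up_leP X Y : reflect (forall w, X w -> Y w) (X <= Y)%O.
Proof. exact: asboolP. Qed.

Program Definition up_meet X Y := @Upset (fun w => X w /\ Y w) _.
Next Obligation. by split; [apply: upsetP H0|apply: upsetP H1]. Qed.

Program Definition up_join X Y := @Upset (fun w => X w \/ Y w) _.
Next Obligation. by case: H0 => H0; [left|right]; apply: upsetP H0. Qed.

Fact up_meetP X Y Z : (X <= up_meet Y Z)%O = (X <= Y)%O && (X <= Z)%O.
Proof.
apply/up_leP/andP => [leX|[/up_leP leXY /up_leP leXZ] w Xw].
  by split; apply/up_leP => w /leX[].
by split; [apply: leXY|apply: leXZ].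
Qed.

Fact up_joinP X Y Z : (up_join X Y <= Z)%O = (X <= Z)%O && (Y <= Z)%O.
Proof.
apply/up_leP/andP => [leZ|[/up_leP leXZ /up_leP leYZ] w [/leXZ|/leYZ]//].
by split; apply/up_leP => w Xw; apply: leZ; [left|right].
Qed.

HB.instance Definition _ :=
  Order.POrder_MeetJoin_isLattice.Build up_display upset up_meetP up_joinP.

Fact up_meetUl : left_distributive up_meet up_join.
Proof. by move=> X Y Z; apply: upset_ext => w /=; tauto. Qed.

HB.instance Definition _ :=
  Order.Lattice_Meet_isDistrLattice.Build up_display upset up_meetUl.

Definition up_bot : upset := @Upset (fun=> False) (fun _ _ _ => id).
Definition up_top : upset := @Upset (fun=> True) (fun _ _ _ => id).

Fact up_le0x X : (up_bot <= X)%O.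
Proof. by apply/up_leP. Qed.

HB.instance Definition _ := Order.hasBottom.Build up_display upset up_le0x.

Fact up_lex1 X : (X <= up_top)%O.
Proof. by apply/up_leP. Qed.

HB.instance Definition _ := Order.hasTop.Build up_display upset up_lex1.

(** [X] met with the set of successors of [Y]; meeting with that set a second time changes nothing,
    whence contraction. *)
Program Definition up_dot X Y :=
  @Upset (fun w => X w /\ exists2 v, Y v & acc v w) _.
Next Obligation.
split; first exact: upsetP H0.
by exists H1 => //; apply: acc_trans H.
Qed.

Program Definition up_imp X Z :=
  @Upset (fun w => forall v, acc w v -> X v -> Z v) _.
Next Obligation. by apply: H0 H2; apply: acc_trans H1. Qed.

(** Heyting implication from the successors of [Y] to [Z]. It ranges over the reflexive closure of
    [acc], since [w] may be a successor of [Y] without seeing itself. *)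
Program Definition up_limp Z Y :=
  @Upset (fun w => forall v, v = w \/ acc w v ->
                   (exists2 u, Y u & acc u v) -> Z v) _.
Next Obligation.
apply: H0; last by exists H2.
by right; case: H1 => [->|] //; apply: acc_trans.
Qed.

Fact up_dot_imp X Y Z : (up_dot X Y <= Z)%O <-> (Y <= up_imp X Z)%O.
Proof.
split=> /up_leP leZ; apply/up_leP => w.
  by move=> Yw v wv Xv; apply: leZ; split=> //; exists w.
by move=> [Xw [v Yv vw]]; apply: leZ vw Xw.
Qed.

Fact up_dot_limp X Y Z : (up_dot X Y <= Z)%O <-> (X <= up_limp Z Y)%O.
Proof.
split=> /up_leP leZ; apply/up_leP => w.
  by move=> Xw v [->|wv] Yv; apply: leZ; split=> //; apply: upsetP Xw.
by move=> [Xw Yw]; apply: leZ Xw _ _ Yw; left.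
Qed.

Fact up_dotx1 X : (up_dot X \top <= X)%O.
Proof. by apply/up_leP => w []. Qed.

Fact up_dot1x X : (up_dot \top X <= X)%O.
Proof. by apply/up_leP => w [_ [v Xv vw]]; apply: upsetP Xv. Qed.

Fact up_dot_contr X Y : (up_dot X Y <= up_dot (up_dot X Y) Y)%O.
Proof. by apply/up_leP => w [Xw Yw]. Qed.

HB.instance Definition _ :=
  TBDistrLattice_isResiduatedBasic.Build up_display upset
    up_dot_imp up_dot_limp up_dotx1 up_dot1x up_dot_contr.

End UpsetAlgebra.

Local Open Scope bpl_scope.
Local Open Scope classical_set_scope.

(** * Theories and prime extensions *)

Section Theories.
Implicit Types (T F : set bpl_formula) (A B C D E G : bpl_formula).

(** A filter for the relation that the implications in [T] define. Provable implications give
    theories; those of a prime theory give the canonical relation. A theory need not detach its own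
    implications. *)
Record theory_over T F : Prop := {
  thy_top : F ⊤;
  thy_and : forall A B, F A -> F B -> F (A ∧ B);
  thy_mp : forall A B, T (A ⟶ B) -> F A -> F B
}.

Notation theory := (theory_over BPL_provable).

Record prime_theory (P : set bpl_formula) : Prop := {
  prime_thy : theory P;
  prime_bot : ~ P ⊥;
  prime_or : forall A B, P (A ∨ B) -> P A \/ P B
}.

Lemma BPL_provable_theory : theory BPL_provable.
Proof.
split=> [|A B pA pB|A B]; last exact: BPL_mp.
  by apply: BPL_mp (BPL_ax (ax_top (⊤ ⟶ ⊤))) (BPL_ax (ax_id ⊤)).
by apply: BPL_mp pB; apply: BPL_mp pA; apply/BPL_ax/ax_pair.
Qed.

Section TheoryLemmas.
Variable T : set bpl_formula.
Hypothesis thyT : theory T.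

Lemma thy_provable A : BPL_provable A -> T A.
Proof.
move=> pA; apply: (thy_mp thyT _ (thy_top thyT)).
by apply: BPL_mp pA; apply/BPL_ax/ax_weak.
Qed.

Lemma thy_ax A : BPL_axiom A -> T A.
Proof. by move=> axA; apply/thy_provable/BPL_ax. Qed.

Lemma thy_weak A B : T B -> T (A ⟶ B).
Proof. by apply: (thy_mp thyT _); apply/BPL_ax/ax_weak. Qed.

Lemma thy_trans A B C : T (A ⟶ B) -> T (B ⟶ C) -> T (A ⟶ C).
Proof.
move=> TAB TBC; apply: (thy_mp thyT _ (thy_and thyT TAB TBC)).
exact/BPL_ax/ax_trans.
Qed.

Lemma thy_imp_and A B C : T (A ⟶ B) -> T (A ⟶ C) -> T (A ⟶ B ∧ C).
Proof.
move=> TAB TAC; apply: (thy_mp thyT _ (thy_and thyT TAB TAC)).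
exact/BPL_ax/ax_and_intro.
Qed.

Lemma thy_or_imp A B C : T (A ⟶ C) -> T (B ⟶ C) -> T (A ∨ B ⟶ C).
Proof.
move=> TAC TBC; apply: (thy_mp thyT _ (thy_and thyT TAC TBC)).
exact/BPL_ax/ax_or_elim.
Qed.

Lemma thy_over_theory F : theory_over T F -> theory F.
Proof.
move=> thyF; split=> [||A B pAB]; [exact: (thy_top thyF)|exact: (thy_and thyF)|].
exact/(thy_mp thyF)/thy_provable.
Qed.

(** For [F] a theory over [T], the least theory over [T] that contains [F] and [C]. *)
Definition adjoin F C := [set E | exists2 G, F G & T (G ∧ C ⟶ E)].

Lemma adjoin_theory_over F C : theory_over T F -> theory_over T (adjoin F C).
Proof.
move=> thyF; split.
- by exists ⊤; [apply: (thy_top thyF)|apply/thy_ax/ax_top].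
- move=> A B [G FG TGA] [G' FG' TGB].
  exists (G ∧ G'); first exact: (thy_and thyF FG FG').
  have proj1 := thy_ax (ax_and_l (G ∧ G') C).
  have proj2 := thy_ax (ax_and_r (G ∧ G') C).
  apply: thy_imp_and.
    apply: (thy_trans _ TGA); apply: thy_imp_and => //.
    by apply: (thy_trans proj1 _); apply/thy_ax/ax_and_l.
  apply: (thy_trans _ TGB); apply: thy_imp_and => //.
  by apply: (thy_trans proj1 _); apply/thy_ax/ax_and_r.
- by move=> A B TAB [G FG TGA]; exists G => //; apply: (thy_trans _ TAB).
Qed.

Lemma sub_adjoin F C : F `<=` adjoin F C.
Proof. by move=> A FA; exists A => //; apply/thy_ax/ax_and_l. Qed.

Lemma mem_adjoin F C : theory_over T F -> adjoin F C C.
Proof. by move=> thyF; exists ⊤; [apply: (thy_top thyF)|apply/thy_ax/ax_and_r]. Qed.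

Lemma adjoin_or F B C D : theory_over T F ->
  F (C ∨ D) -> adjoin F C B -> adjoin F D B -> F B.
Proof.
move=> thyF FCD [G FG TGB] [G' FG' TGB'].
have FGCD := thy_and thyF (thy_and thyF FG FG') FCD.
(* Distributivity splits the premise into a case for [C] and a case for [D], each leading to [B]. *)
apply: (thy_mp thyF _ FGCD); apply: (thy_trans (thy_ax (ax_distr _ _ _)) _).
apply: thy_or_imp.
  apply: (thy_trans _ TGB); apply: thy_imp_and; last exact/thy_ax/ax_and_r.
  by apply: (thy_trans (thy_ax (ax_and_l _ _)) _); apply/thy_ax/ax_and_l.
apply: (thy_trans _ TGB'); apply: thy_imp_and; last exact/thy_ax/ax_and_r.
by apply: (thy_trans (thy_ax (ax_and_l _ _)) _); apply/thy_ax/ax_and_r.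
Qed.

(** A maximal theory over [T] that includes [F] and omits [B] is prime: if it omitted both disjuncts
    of a member, adjoining either would yield [B], and by [adjoin_or] it would contain [B]
    itself. *)
Lemma prime_extension F B : theory_over T F -> ~ F B ->
  exists P, [/\ prime_theory P, theory_over T P, F `<=` P & ~ P B].
Proof.
move=> thyF nFB.
(* Zorn on the part outside [F], so that the empty chain is no exception. *)
pose Q X := theory_over T (F `|` X) /\ ~ (F `|` X) B.
have [|X [[thyP nPB] maxP]] := @Zorn_bigcup _ Q.
  move=> CH CHQ CHtot; split; last first.
    by case=> [//|[X /CHQ[_ nXB] XB]]; apply: nXB; right.
  have lift X A : CH X -> (F `|` X) A -> (F `|` \bigcup_(X in CH) X) A.
    by move=> CX [FA|XA]; [left|right; exists X].
  split=> [|A C|A C TAC]; first by left; apply: (thy_top thyF).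
    case=> [FA|[X CX XA]] [FC|[Y CY YC]].
    - by left; apply: (thy_and thyF FA FC).
    - apply: lift (CY) _; have [thyY _] := CHQ _ CY.
      by apply: (thy_and thyY); [left|right].
    - apply: lift (CX) _; have [thyX _] := CHQ _ CX.
      by apply: (thy_and thyX); [right|left].
    (* Two members of a chain are comparable, so both formulas lie in the larger one. *)
    - have [XY|YX] := CHtot _ _ CX CY.
        apply: lift (CY) _; have [thyY _] := CHQ _ CY.
        by apply: (thy_and thyY); right => //; apply: XY.
      apply: lift (CX) _; have [thyX _] := CHQ _ CX.
      by apply: (thy_and thyX); right => //; apply: YX.
  case=> [FA|[X CX XA]]; first by left; apply: (thy_mp thyF _ FA).
  apply: lift (CX) _; have [thyX _] := CHQ _ CX.
  by apply: (thy_mp thyX TAC _); right.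
(* By maximality, adjoining any formula from outside forces [B] in. *)
have adjB C : ~ (F `|` X) C -> adjoin (F `|` X) C B.
  move=> nPC; apply: contrapT => nB; apply: (maxP (adjoin (F `|` X) C)).
    split=> [A XA|]; first by apply: sub_adjoin; right.
    by move/(_ C (mem_adjoin C thyP)) => XC; apply: nPC; right.
  (* [adjoin] already includes [F], so [Q] here speaks of [adjoin] alone. *)
  have FU : F `|` adjoin (F `|` X) C = adjoin (F `|` X) C.
    by apply/setUidPr => A FA; apply: sub_adjoin; left.
  by split; rewrite FU //; apply: adjoin_theory_over.
exists (F `|` X); split=> [|//|A FA|//]; last by left.
split; first exact: thy_over_theory thyP.
  by move=> Pbot; apply: nPB; apply: (thy_mp thyP _ Pbot); apply/thy_ax/ax_bot.
move=> C D PCD; apply: contrapT => /not_orP[nPC nPD].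
by apply: nPB; apply: adjoin_or thyP PCD (adjB _ nPC) (adjB _ nPD).
Qed.

End TheoryLemmas.

(** * Canonical frame and truth lemma *)

Definition canonical_world := {P | prime_theory P}.

Implicit Types P : canonical_world.

(** The canonical relation: an implication in [P] with its premise in [P'] puts the conclusion in
    [P']. *)
Definition canonical_acc P P' : Prop :=
  theory_over (sval P) (sval P').

(** Weakening puts [⊤ ⟶ A] in [P], and [⊤] lies in [P']. *)
Lemma canonical_acc_sub P P' A : canonical_acc P P' -> sval P A -> sval P' A.
Proof.
move=> PP' PA; apply: (thy_mp PP' _ (thy_top PP')).
exact: (thy_weak (prime_thy (svalP P)) _).
Qed.

Lemma canonical_acc_trans P P' P'' :
  canonical_acc P P' -> canonical_acc P' P'' -> canonical_acc P P''.
Proof.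
move=> PP' P'P''; split=> [||A B PAB]; [exact: (thy_top P'P'')|exact: (thy_and P'P'')|].
exact/(thy_mp P'P'')/canonical_acc_sub/PAB.
Qed.

Definition canonical_frame := TransitiveFrame canonical_acc_trans.

Definition canonical_val (p : nat) : upset canonical_frame :=
  @Upset canonical_frame (fun P => sval P (BVar p))
    (fun P P' PP' => canonical_acc_sub PP').

Lemma truth_lemma A P :
  (rba_eval canonical_val (rbl_of_bpl A) : upset _) P <-> sval P A.
Proof.
elim: A P => [p|||A IHA B IHB|A IHA B IHB|A IHA B IHB] P;
  have [thyP botP orP] := svalP P => //=.
- by split=> // _; apply: (thy_top thyP).
- split=> [[/IHA PA /IHB PB]|PAB]; first exact: (thy_and thyP PA PB).
  by split; [apply/IHA|apply/IHB]; apply: (thy_mp thyP _ PAB); apply/BPL_ax;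
    [apply: ax_and_l|apply: ax_and_r].
- split=> [[/IHA PA|/IHB PB]|/orP[PA|PB]]; [| |by left; apply/IHA|by right; apply/IHB].
    by apply: (thy_mp thyP _ PA); apply/BPL_ax/ax_or_l.
  by apply: (thy_mp thyP _ PB); apply/BPL_ax/ax_or_r.
- split=> [forceAB|PAB P' PP' /IHA P'A]; last by apply/IHB; apply: (thy_mp PP' PAB P'A).
  apply: contrapT => nPAB.
  (* The consequences of [A] within [P] form a theory over [P] with [A] inside and [B] outside; a
     prime extension over [P] is then a successor of [P] that refutes the implication. *)
  have thyF : theory_over (sval P) [set C | sval P (A ⟶ C)].
    split=> [|C D|C D]; first exact/(thy_ax thyP)/ax_top.
      exact: thy_imp_and.
    by move=> PCD PAC; apply: (thy_trans thyP) PCD.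
  have [P' [primeP' thyP' FP' nP'B]] := prime_extension thyP thyF nPAB.
  apply/nP'B/(IHB (exist _ P' primeP'))/forceAB => //.
  by apply/IHA/FP'/(thy_ax thyP)/ax_id.
Qed.

End Theories.

(** * Completeness and conservativity *)

Lemma BPL_complete (A : bpl_formula) : RBL (rbl_of_bpl A) -> BPL_provable A.
Proof.
move=> A_valid; apply: contrapT => nA.
have thy := BPL_provable_theory.
have [P [primeP _ _ nPA]] := prime_extension thy thy nA.
apply/nPA/(truth_lemma A (exist _ P primeP)).
(* A valid formula evaluates to the top upset, which contains every world. *)
by rewrite (A_valid _ _ _ (rba_eval_assignment canonical_val)).
Qed.

Theorem theorem6 (A : bpl_formula) : BPL_provable A <-> RBL (rbl_of_bpl A).
Proof. by split; [apply: BPL_sound|apply: BPL_complete]. Qed.
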